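(* Let $p>n\ge 1$ be integers, let $\beta\in\mathbb{R}^p$, and let $y=X\beta+\varepsilon$, where $X\in\mathbb{R}^{n\times p}$ is a random matrix, $\varepsilon\in\mathbb{R}^n$ is a random vector independent of $X$ with $\mathbb{E}[\varepsilon]=0$, and $\Omega:=\mathbb{E}[\varepsilon\varepsilon^\top]$ is finite and positive definite. Assume that $X$ is left-spherical, and let $\hat\beta=X^\dagger y$. Then $$\mathbb{E}_X\big[\mathrm{Var}(\hat\beta\mid X)\big]=\frac1{np}\,\mathrm{Tr}(\Omega)\,\mathbb{E}_X\big[\mathrm{Tr}(\Lambda^\dagger)\big],$$ where $XX^\top/p=U\Lambda U^\top$ for some orthogonal matrix $U\in O(n)$ and diagonal matrix $\Lambda$ (an eigendecomposition of $XX^\top/p$).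
   Context: $A^\dagger$ denotes the Moore–Penrose inverse of a matrix $A$. The ridgeless (minimum $\ell_2$ norm) least squares estimator is $\hat\beta:=\arg\min_{b\in\mathbb{R}^p}\{\|b\|:Xb=y\}=(X^\top X)^\dagger X^\top y=X^\dagger y$. $\mathrm{Var}(\hat\beta\mid X):=\mathrm{Tr}(\mathrm{Cov}(\hat\beta\mid X))$, where $\mathrm{Cov}(\hat\beta\mid X)$ is the conditional covariance matrix given $X$. A random matrix $Z$ with $n$ rows is called left-spherical if $OZ$ and $Z$ have the same distribution for every fixed orthogonal matrix $O\in O(n)=\{A\in\mathbb{R}^{n\times n}:AA^\top=A^\top A=I\}$. $\mathbb{E}_X$ denotes expectation over $X$. *)

(* Defs.v *)
From HB Require Import structures.
From mathcomp Require Import all_boot all_order all_algebra.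
From mathcomp Require Import all_classical all_reals all_analysis.
Set Implicit Arguments.
Unset Strict Implicit.
Unset Printing Implicit Defensive.
Import Order.TTheory GRing.Theory Num.Theory.
Import numFieldNormedType.Exports.
Local Open Scope classical_set_scope.
Local Open Scope ring_scope.

Definition is_moore_penrose (R : nzRingType) m n (A : 'M[R]_(m, n))
    (B : 'M[R]_(n, m)) : Prop :=
  [/\ A *m B *m A = A, B *m A *m B = B,
      (A *m B)^T = A *m B & (B *m A)^T = B *m A].

(* The default value 0 is never reached: see [mpinvP]. *)
Definition mpinv (R : realType) m n (A : 'M[R]_(m, n)) : 'M[R]_(n, m) :=
  xget 0 [set B | is_moore_penrose A B].

Section moore_penrose.
Variable R : realType.

Lemma moore_penrose_uniq m n (A : 'M[R]_(m, n)) (B C : 'M[R]_(n, m)) :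
  is_moore_penrose A B -> is_moore_penrose A C -> B = C.
Proof.
move=> [b1 b2 b3 b4] [c1 c2 c3 c4].
have eAB : A *m B = A *m C.
  by rewrite -b3 -{1}c1 -(mulmxA (A *m C)) trmx_mul c3 b3 mulmxA b1.
have eBA : B *m A = C *m A.
  have -> : B *m A = (B *m A) *m (C *m A) by rewrite mulmxA -!(mulmxA B) c1.
  by rewrite -{1}b4 -{1}c4 -trmx_mul -(mulmxA C) (mulmxA A) b1 c4.
by rewrite -b2 -mulmxA eAB mulmxA eBA c2.
Qed.

Lemma gram_eq0 k n (B : 'M[R]_(k, n)) : B *m B^T = 0 -> B = 0.
Proof.
move=> h; apply/matrixP => i j; rewrite !mxE.
have := congr1 (fun M : 'M[R]_k => M i i) h; rewrite !mxE => /eqP.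
rewrite psumr_eq0 => [/allP /(_ j)|l _]; rewrite !mxE -expr2 ?sqr_ge0//.
by rewrite mem_index_enum sqrf_eq0 => /(_ isT) /eqP.
Qed.

Lemma row_free_gram_unit k n (B : 'M[R]_(k, n)) :
  row_free B -> B *m B^T \in unitmx.
Proof.
move=> fB; rewrite -row_free_unit -kermx_eq0; apply/eqP.
set K := kermx _; apply: (row_free_inj fB); rewrite mul0mx.
by apply: gram_eq0; rewrite trmx_mul mulmxA -(mulmxA K) mulmx_ker mul0mx.
Qed.

Lemma moore_penrose_exists m n (A : 'M[R]_(m, n)) :
  exists B, is_moore_penrose A B.
Proof.
have uR := row_free_gram_unit (row_base_free A).
have uC : (col_base A)^T *m col_base A \in unitmx.
  rewrite -[X in _ *m X]trmxK; apply: row_free_gram_unit.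
  by rewrite /row_free mxrank_tr; exact: col_base_full.
move: (\rank A) (col_base A) (row_base A) (mulmx_base A) uR uC => r C D eA.
move=> uG uH.
pose G := D *m D^T; pose H := C^T *m C.
have GE : D *m D^T = G by []. have HE : C^T *m C = H by [].
have sG : (invmx G)^T = invmx G by rewrite trmx_inv /G trmx_mul trmxK.
have sH : (invmx H)^T = invmx H by rewrite trmx_inv /H trmx_mul trmxK.
rewrite GE in uG; rewrite HE in uH; clearbody G H.
pose B := D^T *m invmx G *m (invmx H *m C^T).
have eAB : A *m B = C *m invmx H *m C^T.
  rewrite -eA /B !mulmxA -(mulmxA C D) GE.
  by rewrite -(mulmxA C G) mulmxV// mulmx1.
have eBA : B *m A = D^T *m invmx G *m D.
  rewrite -eA /B !mulmxA -(mulmxA _ C^T) HE.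
  by rewrite -(mulmxA _ (invmx H) H) mulVmx// mulmx1.
exists B; split.
- rewrite eAB -eA !mulmxA -(mulmxA _ C^T C) HE.
  by rewrite -(mulmxA _ (invmx H) H) mulVmx// mulmx1.
- rewrite eBA /B !mulmxA -(mulmxA _ D D^T) GE.
  by rewrite -(mulmxA _ (invmx G) G) mulVmx// mulmx1.
- by rewrite eAB !trmx_mul trmxK sH mulmxA.
- by rewrite eBA !trmx_mul trmxK sG mulmxA.
Qed.

Lemma mpinvP m n (A : 'M[R]_(m, n)) : is_moore_penrose A (mpinv A).
Proof. exact: xgetPex (moore_penrose_exists A). Qed.

End moore_penrose.

Definition orthogonal_mx (R : nzRingType) n (O : 'M[R]_n) : Prop :=
  O *m O^T = 1%:M /\ O^T *m O = 1%:M.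

Definition posdef_mx (R : realType) n (A : 'M[R]_n) : Prop :=
  A^T = A /\ forall v : 'cV[R]_n, v != 0 -> 0 < (v^T *m A *m v) ord0 ord0.

Definition is_eigendecomposition (R : nzRingType) n (S U L : 'M[R]_n) : Prop :=
  [/\ orthogonal_mx U, is_diag_mx L & S = U *m L *m U^T].

Definition mx_cylinder (R : realType) m n : set (set 'M[R]_(m, n)) :=
  [set A | exists i j, exists2 B : set R, measurable B &
           A = (fun M : 'M[R]_(m, n) => M i j) @^-1` B].

(* m x n matrices with the product (equivalently, Borel) sigma-algebra of
   R^(m x n), i.e. the one generated by the coordinate functions. *)
Notation borel_mx R m n := (g_sigma_algebraType (@mx_cylinder R m n)).

Definition left_spherical d (T : measurableType d) (R : realType)
    (P : probability T R) n p (Z : {RV P >-> borel_mx R n p}) : Prop :=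
  forall O : 'M[R]_n, orthogonal_mx O ->
  forall A : set (borel_mx R n p), measurable A ->
    pushforward P (fun w => O *m Z w : borel_mx R n p) A = distribution P Z A.

Section conditioning.
Context d d1 d2 (T : measurableType d) (T1 : measurableType d1)
  (T2 : measurableType d2) (R : realType) (P : probability T R).

Definition independent_RV (X : {RV P >-> T1}) (Y : {RV P >-> T2}) : Prop :=
  forall (A : set T1) (B : set T2), measurable A -> measurable B ->
    (P (X @^-1` A `&` Y @^-1` B) = P (X @^-1` A) * P (Y @^-1` B))%E.

(* Z is a version of the conditional expectation E[Y | X]. For integrable Y
   this is the usual definition; in general Y is only required to be integrable
   on each member of a countable cover by events of sigma(X), which is what
   makes E[Y | X] meaningful, finite and a.s. unique for non-integrable Y. *)
Definition is_cond_expectation (X : {RV P >-> T1}) (Y Z : T -> R) : Prop :=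
  [/\ measurable_fun [set: g_sigma_algebra_preimageType X] Z,
      exists F : (set T)^nat,
        [/\ forall k, g_sigma_algebra_preimage X (F k),
            \bigcup_k F k = [set: T] &
            forall k, P.-integrable (F k) (EFin \o Y)]
    & forall A : set T, g_sigma_algebra_preimage X A ->
        P.-integrable A (EFin \o Y) ->
        P.-integrable A (EFin \o Z) /\
        (\int[P]_(w in A) (Z w)%:E = \int[P]_(w in A) (Y w)%:E)%E].

Definition is_cond_covariance (X : {RV P >-> T1}) p (Y : T -> 'cV[R]_p)
    (C : T -> 'M[R]_p) : Prop :=
  exists2 mu : T -> 'cV[R]_p,
    forall i, is_cond_expectation X (fun w => Y w i ord0) (fun w => mu w i ord0)
  & forall i j, is_cond_expectation X
      (fun w => (Y w i ord0 - mu w i ord0) * (Y w j ord0 - mu w j ord0))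
      (fun w => C w i j).

Definition is_cond_variance (X : {RV P >-> T1}) p (Y : T -> 'cV[R]_p)
    (V : T -> R) : Prop :=
  exists2 C : T -> 'M[R]_p, is_cond_covariance X Y C
                          & forall w, V w = \tr (C w).

End conditioning.

Definition ridgeless (R : realType) n p (X : 'M[R]_(n, p)) (y : 'cV[R]_n) :
  'cV[R]_p := mpinv X *m y.

(* Main.v *)
(** Write X^+ for the pseudoinverse. Given X, the estimator is X^+ X beta plus
    X^+ eps, so by independence its conditional covariance is X^+ Omega X^+^T.
    Since (O X)^+ = X^+ O^T for orthogonal O, left-sphericity lets us replace
    Omega by O^T Omega O inside the expected trace. Averaging over the finite
    family of signed cyclic shifts turns Omega into (tr Omega / n) I, leaving
    E[tr (X^+ X^+^T)], and X^+^T X^+ = (X X^T)^+. As all integrands are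
    nonnegative, the computation also holds when the expectations are
    infinite. *)

Require Import Defs.
From HB Require Import structures.
From mathcomp Require Import all_boot all_order all_algebra.
From mathcomp Require Import all_classical all_reals all_analysis.
From mathcomp Require Import ring measurable_realfun.
Set Implicit Arguments.
Unset Strict Implicit.
Unset Printing Implicit Defensive.
Import Order.TTheory GRing.Theory Num.Theory.
Import numFieldNormedType.Exports.
Local Open Scope classical_set_scope.
Local Open Scope ring_scope.

(** * Algebra of the Moore-Penrose inverse *)

Section moore_penrose_theory.
Variable R : realType.

Lemma mpinv_eq m n (A : 'M[R]_(m, n)) B : is_moore_penrose A B -> mpinv A = B.
Proof. exact: moore_penrose_uniq (mpinvP A). Qed.

(** With B the pseudoinverse of A, the orthogonal factors cancel in (B O^T)(O A), and (O A)(B O^T)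
    is the symmetric matrix A B conjugated by O. The four Penrose equations therefore carry over. *)
Lemma mpinv_orthogonalMl m n (O : 'M[R]_m) (A : 'M[R]_(m, n)) :
  orthogonal_mx O -> mpinv (O *m A) = mpinv A *m O^T.
Proof.
move=> [_ OO]; apply: mpinv_eq.
have [a1 a2 a3 a4] := mpinvP A; move: (mpinv A) a1 a2 a3 a4 => B a1 a2 a3 a4.
have BOA : B *m O^T *m (O *m A) = B *m A.
  by rewrite mulmxA -(mulmxA B) OO mulmx1.
split.
- by rewrite -!mulmxA (mulmxA O^T) OO mul1mx (mulmxA A) a1.
- by rewrite BOA mulmxA a2.
- rewrite (_ : _ *m _ = O *m (A *m B) *m O^T); last by rewrite !mulmxA.
  by rewrite trmx_mul trmxK trmx_mul a3 mulmxA.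
- by rewrite BOA.
Qed.

(** With B the pseudoinverse of A, both products of A A^T and B^T B collapse to the symmetric
    projection A B. *)
Lemma mpinv_gram m n (A : 'M[R]_(m, n)) :
  mpinv (A *m A^T) = (mpinv A)^T *m mpinv A.
Proof.
apply: mpinv_eq.
have [a1 a2 a3 a4] := mpinvP A; move: (mpinv A) a1 a2 a3 a4 => B a1 a2 a3 a4.
have ABt : A^T *m B^T = B *m A by rewrite -trmx_mul.
have BAt : B^T *m A^T = A *m B by rewrite -trmx_mul.
have e1 : A *m A^T *m (B^T *m B) = A *m B.
  by rewrite mulmxA -(mulmxA A) ABt mulmxA a1.
have e2 : B^T *m B *m (A *m A^T) = A *m B.
  by rewrite -mulmxA (mulmxA B) -{1}a4 -trmx_mul mulmxA a1 BAt.
split.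
- by rewrite e1 mulmxA a1.
- by rewrite e2 mulmxA -{1}a3 -trmx_mul mulmxA a2.
- by rewrite e1.
- by rewrite e2.
Qed.

Lemma mpinvZ m n (c : R) (A : 'M[R]_(m, n)) :
  c != 0 -> mpinv (c *: A) = c^-1 *: mpinv A.
Proof.
move=> c0; apply: mpinv_eq; have [a1 a2 a3 a4] := mpinvP A.
have AB : (c *: A) *m (c^-1 *: mpinv A) = A *m mpinv A.
  by rewrite -scalemxAl -scalemxAr scalerA divff// scale1r.
have BA : (c^-1 *: mpinv A) *m (c *: A) = mpinv A *m A.
  by rewrite -scalemxAl -scalemxAr scalerA mulVf// scale1r.
by split; rewrite ?AB ?BA -?scalemxAr ?a1 ?a2.
Qed.

(** Conjugation by U respects products and transposes, so it commutes with the pseudoinverse;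
    cyclicity of the trace then removes U. *)
Lemma mxtrace_mpinv_conj n (U L : 'M[R]_n) :
  orthogonal_mx U -> \tr (mpinv (U *m L *m U^T)) = \tr (mpinv L).
Proof.
move=> oU; have [_ UU] := oU.
suff -> : mpinv (U *m L *m U^T) = U *m mpinv L *m U^T.
  by rewrite mxtrace_mulC mulmxA UU mul1mx.
apply: mpinv_eq; have [a1 a2 a3 a4] := mpinvP L.
move: (mpinv L) a1 a2 a3 a4 => B a1 a2 a3 a4.
have conjM (C D : 'M[R]_n) :
    U *m C *m U^T *m (U *m D *m U^T) = U *m (C *m D) *m U^T.
  by rewrite -!mulmxA (mulmxA U^T) UU mul1mx.
split; rewrite !conjM ?a1 ?a2//.
- by rewrite !trmx_mul trmxK -trmx_mul a3 mulmxA.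
- by rewrite !trmx_mul trmxK -trmx_mul a4 mulmxA.
Qed.

End moore_penrose_theory.

(* The pseudoinverse is the limit of A^T (A A^T + t I)^-1 as t -> 0; this makes
   it a Borel function of A, although it is not continuous. *)
Section regularization.
Variables (R : realType) (m n : nat) (A : 'M[R]_(m, n)).

Let S := A *m A^T.

(** If K (S + t I) = 0, multiplying by K^T gives (K A)(K A)^T + t K K^T = 0. Both diagonals are sums
    of squares and t > 0, so K = 0. *)
Lemma gram_regularized_unit (t : R) : 0 < t -> S + t%:M \in unitmx.
Proof.
move=> t0; rewrite -row_free_unit -kermx_eq0; apply/eqP.
move: (kermx _) (mulmx_ker (S + t%:M)) => K K0.
have Kge0 (p : nat) (B : 'M[R]_(m, p)) i : 0 <= (B *m B^T) i i.
  by rewrite mxE; apply: sumr_ge0 => j _; rewrite mxE -expr2 sqr_ge0.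
have : (K *m A) *m (K *m A)^T + t *: (K *m K^T) = 0.
  rewrite trmx_mul mulmxA -(mulmxA K) -/S scalemxAl -mul_mx_scalar.
  by rewrite -mulmxDl -mulmxDr K0 mul0mx.
move=> h; apply/matrixP => i j; rewrite [RHS]mxE.
have /eqP : (K *m A *m (K *m A)^T) i i + t * (K *m K^T) i i = 0.
  by have := congr1 (fun M : 'M[R]_m => M i i) h; rewrite !mxE.
rewrite paddr_eq0 ?Kge0 ?mulr_ge0 ?Kge0 ?ltW// => /andP[_].
rewrite mulf_eq0 gt_eqF//= mxE psumr_eq0 => [/allP /(_ j)|l _].
  by rewrite mem_index_enum mxE -expr2 sqrf_eq0 => /(_ isT)/eqP.
by rewrite mxE -expr2 sqr_ge0.
Qed.

(** M = t (S + t I)^-1 is symmetric and satisfies M^T S M + t M^T M = t M. Reading off diagonal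
    entries gives M_kj^2 <= M_jj for every k; the case k = j forces M_jj <= 1, which then bounds the
    whole column. *)
Lemma gram_resolvent_le1 (t : R) i j :
  0 < t -> `|(t *: invmx (S + t%:M)) i j| <= 1.
Proof.
move=> t0; have u := gram_regularized_unit t0; set M := t *: _.
have MS : M^T = M.
  rewrite /M linearZ /= trmx_inv linearD /= tr_scalar_mx.
  by rewrite /S trmx_mul trmxK.
have SM : (S + t%:M) *m M = t%:M.
  by rewrite /M -scalemxAr mulmxV// scalemx1.
clearbody M.
have e : (M^T *m A) *m (M^T *m A)^T + t *: (M^T *m M) = t *: M.
  rewrite trmx_mul trmxK mulmxA -(mulmxA _ A) -/S scalemxAl -mul_mx_scalar.
  by rewrite -mulmxDl -mulmxDr -mulmxA SM mul_mx_scalar MS.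
have {}e : (M^T *m A *m (M^T *m A)^T) j j + t * (M^T *m M) j j = t * M j j.
  by have := congr1 (fun B : 'M[R]_m => B j j) e; rewrite !mxE.
have M2 k : M k j ^+ 2 <= M j j.
  rewrite -(ler_pM2l t0) -e ler_wpDl//.
    by rewrite mxE; apply: sumr_ge0 => l _; rewrite [_^T l j]mxE -expr2 sqr_ge0.
  rewrite ler_pM2l// mxE (bigD1 k)//= mxE -expr2 lerDl.
  by apply: sumr_ge0 => l _; rewrite mxE -expr2 sqr_ge0.
have M1 : M j j <= 1.
  rewrite leNgt; apply/negP => h; have := M2 j.
  rewrite leNgt => /negP; apply.
  by rewrite expr2 ltr_pMl// (lt_trans _ h).
by rewrite -(expr_le1 (n := 2))// -normrX ger0_norm ?sqr_ge0// (le_trans (M2 i)).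
Qed.

(** This isolates an error with an explicit factor t. With B the pseudoinverse, it follows from A^T
    = B S, from B = B B^T B S, and from S (S + t I)^-1 = I - t (S + t I)^-1. *)
Lemma regularized_mpinvE (t : R) : 0 < t ->
  A^T *m invmx (S + t%:M) = mpinv A
    - t *: (mpinv A *m (mpinv A)^T *m mpinv A *m (1%:M - t *: invmx (S + t%:M))).
Proof.
move=> t0; have u := gram_regularized_unit t0.
have [a1 a2 a3 a4] := mpinvP A; move: (mpinv A) a1 a2 a3 a4 => B a1 a2 a3 a4.
have BS : B *m S = A^T.
  by rewrite /S mulmxA -a4 -trmx_mul mulmxA a1.
have BBBS : B *m B^T *m B *m S = B.
  by rewrite -!mulmxA BS -trmx_mul a3 mulmxA a2.
have SI : S *m invmx (S + t%:M) = 1%:M - t *: invmx (S + t%:M).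
  apply/eqP; rewrite -subr_eq0 opprB addrA subr_eq0 -mul_scalar_mx -mulmxDl.
  by rewrite mulmxV.
by rewrite -{1}BS -mulmxA SI mulmxBr mulmx1 -SI mulmxA BBBS -scalemxAr.
Qed.

Lemma regularized_mpinv_cvg i j :
  (A^T *m invmx (S + (k.+1%:R^-1)%:M)) i j @[k --> \oo] --> mpinv A i j.
Proof.
set B := mpinv A *m (mpinv A)^T *m mpinv A.
apply/cvgrPdist_le => e e0.
(* Entries of I - t (S + t I)^-1 are at most 1 + 1 = 2 in absolute value, so the error is at most t
   c. Dividing by c + 1 below avoids the case c = 0. *)
pose c := \sum_l `|B i l| * 2.
have c0 : 0 <= c by apply: sumr_ge0 => l _; rewrite mulr_ge0.
have := @cvg_harmonic R => /cvgrPdist_le/(_ (e / (c + 1))).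
have c1 : 0 < c + 1 by rewrite ltr_wpDl.
rewrite divr_gt0// => /(_ isT); apply: filterS => k.
rewrite sub0r normrN ger0_norm ?harmonic_ge0// ler_pdivlMr// => ke.
have t0 : 0 < k.+1%:R^-1 :> R by rewrite invr_gt0.
rewrite regularized_mpinvE// !mxE opprB addrC subrK normrM gtr0_norm//.
apply: le_trans ke; rewrite ler_pM2l// ler_wpDr//.
apply: le_trans (ler_norm_sum _ _ _) _; apply: ler_sum => l _.
rewrite normrM ler_wpM2l//.
have := gram_resolvent_le1 l j t0; rewrite !mxE => h.
apply: le_trans (ler_normB _ _) _; rewrite (_ : 2 = 1 + 1)// lerD//.
by case: eqP; rewrite /= ?normr1 ?normr0.
Qed.

End regularization.

Lemma mxtrace_gram_ge0 (R : realDomainType) m n (A : 'M[R]_(m, n)) :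
  0 <= \tr (A *m A^T).
Proof.
apply: sumr_ge0 => i _; rewrite mxE; apply: sumr_ge0 => j _.
by rewrite mxE -expr2 sqr_ge0.
Qed.

(** Each diagonal entry is the quadratic form of S at a row of B. *)
Lemma psd_mxtrace_conj_ge0 (R : realDomainType) m n (S : 'M[R]_n)
    (B : 'M[R]_(m, n)) :
  (forall v : 'cV[R]_n, 0 <= (v^T *m S *m v) ord0 ord0) ->
  0 <= \tr (B *m S *m B^T).
Proof.
move=> S0; apply: sumr_ge0 => i _; have := S0 (row i B)^T.
rewrite trmxK -row_mul !mxE; congr (0 <= _); apply: eq_bigr => j _.
by rewrite !mxE.
Qed.

(** * Averaging over signed cyclic shifts *)

Section twirling.
Variables (R : realType) (n : nat).

(** The size is a successor so that ordinals add modulo it: [u.1] is a cyclic shift, and [u.2]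
    chooses a sign for each row. *)
Definition signed_shift (u : 'I_n.+1 * {ffun 'I_n.+1 -> bool}) : 'M[R]_n.+1 :=
  \matrix_(i, j) ((-1) ^+ u.2 i *+ (j == i + u.1)).

Lemma signed_shift_mulE u (A : 'M[R]_n.+1) i b :
  (signed_shift u *m A) i b = (-1) ^+ u.2 i * A (i + u.1) b.
Proof.
rewrite mxE (bigD1 (i + u.1))//= big1 => [|l li]; rewrite mxE.
  by rewrite eqxx addr0 mulr1n.
by rewrite (negbTE li) mulr0n mul0r.
Qed.

Lemma signed_shift_orthogonal u : orthogonal_mx (signed_shift u).
Proof.
suff h : signed_shift u *m (signed_shift u)^T = 1%:M.
  by split => //; exact: mulmx1C.
apply/matrixP => i j; rewrite signed_shift_mulE !mxE (inj_eq (addIr _)).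
by case: eqVneq => [->|_]; rewrite ?mulr0n ?mulr0// mulr1n -expr2 sqrr_sign.
Qed.

(** For distinct a and b, flipping the sign at a is an involution that negates every summand, so the
    sum equals its own opposite. *)
Lemma sum_sign_mul (a b : 'I_n.+1) :
  \sum_(e : {ffun 'I_n.+1 -> bool}) (-1) ^+ e a * (-1) ^+ e b
    = (2 ^ n.+1)%:R *+ (a == b) :> R.
Proof.
have [->|ab] := eqVneq a b.
  under eq_bigr do rewrite -expr2 sqrr_sign.
  by rewrite sumr_const card_ffun card_bool card_ord.
pose flip (e : {ffun 'I_n.+1 -> bool}) := [ffun i => (i == a) (+) e i].
have flipK : involutive flip.
  by move=> e; apply/ffunP => i; rewrite !ffunE addbA addbb.
set s := LHS; suff : s = - s.
  by move/eqP; rewrite -addr_eq0 -mulr2n mulrn_eq0 => /eqP.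
rewrite {1}/s (reindex_inj (inv_inj flipK)) -sumrN; apply: eq_bigr => e _.
by rewrite !ffunE eqxx eq_sym (negbTE ab) signr_addb expr1 mulN1r mulNr.
Qed.

(** Summing over signs kills the off-diagonal entries; summing over shifts then runs through the
    whole diagonal of A at each position. *)
Lemma sum_signed_shift_conj (A : 'M[R]_n.+1) :
  \sum_u (signed_shift u)^T *m A *m signed_shift u = ((2 ^ n.+1)%:R * \tr A)%:M.
Proof.
have conjE u a b : ((signed_shift u)^T *m A *m signed_shift u) a b =
    (-1) ^+ u.2 (a - u.1) * (-1) ^+ u.2 (b - u.1) * A (a - u.1) (b - u.1).
  rewrite -mulmxA mxE (bigD1 (a - u.1))//= big1 => [|l li]; last first.
    by rewrite !mxE -subr_eq eq_sym (negbTE li) mulr0n mul0r.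
  rewrite !mxE subrK eqxx mulr1n addr0 -mulrA; congr (_ * _).
  rewrite (bigD1 (b - u.1))//= big1 => [|l li]; last first.
    by rewrite !mxE -subr_eq eq_sym (negbTE li) mulr0n mulr0.
  by rewrite !mxE subrK eqxx mulr1n addr0 mulrC.
apply/matrixP => a b; rewrite summxE.
under eq_bigr do rewrite conjE.
rewrite -(pair_bigA _ (fun k (e : {ffun 'I_n.+1 -> bool}) =>
  (-1) ^+ e (a - k) * (-1) ^+ e (b - k) * A (a - k) (b - k)))/=.
under eq_bigr do rewrite -mulr_suml sum_sign_mul (inj_eq (addIr _)).
rewrite mxE; have [->|ab] := eqVneq a b; last first.
  rewrite mulr0n big1// => k _; exact: mul0r.
under eq_bigr do rewrite mulr1n.
rewrite mulr1n -mulr_sumr; congr (_ * _).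
by rewrite [RHS](reindex_inj (subrI b)).
Qed.

End twirling.

Lemma orthogonal_twirl (R : realType) n : (0 < n)%N ->
  exists (I : finType) (O : I -> 'M[R]_n),
    [/\ (0 < #|I|)%N, forall i, orthogonal_mx (O i) &
        forall A, \sum_i (O i)^T *m A *m O i = (#|I|%:R * (\tr A / n%:R))%:M].
Proof.
case: n => // n _.
exists ('I_n.+1 * {ffun 'I_n.+1 -> bool})%type, (@signed_shift R n).
have cardE : #|{: 'I_n.+1 * {ffun 'I_n.+1 -> bool}}| = (n.+1 * 2 ^ n.+1)%N.
  by rewrite card_prod card_ffun card_bool card_ord.
split=> [||A]; first by rewrite cardE muln_gt0 expn_gt0.
  exact: signed_shift_orthogonal.
rewrite sum_signed_shift_conj cardE natrM; congr (_%:M).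
by rewrite mulrAC mulrCA divff ?mulr1 1?mulrC// pnatr_eq0.
Qed.

(** * Measurability of matrix-valued maps *)

Section measurable_matrices.
Context d (T : measurableType d) (R : realType).

Definition measurable_entries m n (F : T -> 'M[R]_(m, n)) : Prop :=
  forall i j, measurable_fun [set: T] (fun x => F x i j).

Lemma measurable_entries_cst m n (A : 'M[R]_(m, n)) :
  measurable_entries (fun=> A).
Proof. by move=> i j; exact: measurable_cst. Qed.

Lemma measurable_entries_tr m n (F : T -> 'M[R]_(m, n)) :
  measurable_entries F -> measurable_entries (fun x => (F x)^T).
Proof. by move=> mF i j; under eq_fun do rewrite mxE; exact: mF. Qed.

Lemma measurable_entries_add m n (F G : T -> 'M[R]_(m, n)) :
  measurable_entries F -> measurable_entries G ->
  measurable_entries (fun x => F x + G x).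
Proof.
by move=> mF mG i j; under eq_fun do rewrite mxE; exact: measurable_funD.
Qed.

Lemma measurable_entries_mul m n p (F : T -> 'M[R]_(m, n))
    (G : T -> 'M[R]_(n, p)) :
  measurable_entries F -> measurable_entries G ->
  measurable_entries (fun x => F x *m G x).
Proof.
move=> mF mG i j; under eq_fun do rewrite mxE.
by apply: measurable_sum => k; exact: measurable_funM.
Qed.

Lemma measurable_mxtrace n (F : T -> 'M[R]_n) :
  measurable_entries F -> measurable_fun [set: T] (fun x => \tr (F x)).
Proof. by move=> mF; apply: measurable_sum => k; exact: mF. Qed.

Lemma measurable_determinant n (F : T -> 'M[R]_n) :
  measurable_entries F -> measurable_fun [set: T] (fun x => \det (F x)).
Proof.
move=> mF; apply: measurable_sum => s; apply: measurable_funM => //.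
by apply: measurable_prod => i _; exact: mF.
Qed.

Lemma measurable_entries_adjugate n (F : T -> 'M[R]_n) :
  measurable_entries F -> measurable_entries (fun x => \adj (F x)).
Proof.
move=> mF i j; under eq_fun do rewrite mxE /cofactor.
apply: measurable_funM => //; apply: measurable_determinant => k l.
by under eq_fun do rewrite !mxE; exact: mF.
Qed.

Lemma measurable_inv (f : T -> R) :
  measurable_fun [set: T] f -> measurable_fun [set: T] (fun x => (f x)^-1).
Proof.
(* The inverse is written as y (y^2)^-1, so that the real power has a nonnegative base. At y = 0
   both sides are 0 by the convention for [invr0]. *)
move=> mf; rewrite (_ : (fun x => _) = (fun x => f x * powR (f x ^+ 2) (- 1))).
  apply: measurable_funM => //.
  apply: (measurableT_comp (f := fun y : R => powR y (- 1))).
    exact: measurable_powR.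
  exact: measurable_funX.
apply/funext => x; rewrite powR_inv1 ?sqr_ge0// expr2 invfM.
have [->|f0] := eqVneq (f x) 0; first by rewrite invr0 mul0r.
by rewrite mulVKf.
Qed.

Lemma measurable_entries_inv n (F : T -> 'M[R]_n) :
  measurable_entries F -> (forall x, F x \in unitmx) ->
  measurable_entries (fun x => invmx (F x)).
Proof.
move=> mF uF i j; under eq_fun do rewrite /invmx uF mxE.
apply: measurable_funM; last exact: measurable_entries_adjugate.
exact/measurable_inv/measurable_determinant.
Qed.

(** A pointwise limit of the regularized inverses with t = 1/(k+1), each measurable by the cofactor
    formula. *)
Lemma measurable_entries_mpinv m n (F : T -> 'M[R]_(m, n)) :
  measurable_entries F -> measurable_entries (fun x => mpinv (F x)).
Proof.
move=> mF i j; apply: measurable_fun_cvg => [k|x _]; last first.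
  exact: regularized_mpinv_cvg.
apply: measurable_entries_mul; first exact: measurable_entries_tr.
apply: measurable_entries_inv => [|x]; last exact: gram_regularized_unit.
apply: measurable_entries_add; last exact: measurable_entries_cst.
by apply: measurable_entries_mul => //; exact: measurable_entries_tr.
Qed.

(** Links entrywise measurability with the generated sigma-algebra; for the converse it is enough to
    test the generating cylinders. *)
Lemma measurable_borel_mxP m n (F : T -> borel_mx R m n) :
  measurable_fun [set: T] F <-> @measurable_entries m n F.
Proof.
split=> [mF i j|mF].
  apply: (measurableT_comp (f := fun M : borel_mx R m n => (M : 'M[R]_(m, n)) i j)) => //.
  move=> _ B mB; rewrite setTI; apply: sub_sigma_algebra.
  by exists i, j, B.
apply: (@measurability _ _ T (borel_mx R m n) setT F (@mx_cylinder R m n)) => //.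
move=> _ [_ [i [j [B mB ->]]] <-]; rewrite setTI.
by rewrite -[X in measurable X]setTI; exact: mF.
Qed.

End measurable_matrices.

Lemma measurable_entries_id (R : realType) m n :
  measurable_entries (fun M : borel_mx R m n => (M : 'M[R]_(m, n))).
Proof.
by apply/(measurable_borel_mxP (fun M : borel_mx R m n => M)); exact: measurable_id.
Qed.

(** * Independence and product laws *)

Section independence.
Context d d1 d2 (T : measurableType d) (T1 : measurableType d1)
  (T2 : measurableType d2) (R : realType) (P : probability T R).
Variables (X : {RV P >-> T1}) (Y : {RV P >-> T2}).

Let XY w := (X w, Y w).

Let mXY : measurable_fun [set: T] XY.
Proof. exact: measurable_fun_pair. Qed.

HB.instance Definition _ := isMeasurableFun.Build _ _ _ _ XY mXY.

(** Independence says that the joint law agrees with the product law on rectangles, which determines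
    the latter. *)
Lemma independent_distribution : independent_RV X Y ->
  forall A, measurable A ->
  (distribution P X \x distribution P Y)%E A = distribution P XY A.
Proof.
by move=> indep A mA; exact: product_measure_unique.
Qed.

Lemma bounded_integrableM (D : set T) (f g : T -> R) (M : R) :
  measurable D -> measurable_fun D f -> (forall w, D w -> `|f w| <= M) ->
  P.-integrable D (EFin \o g) -> P.-integrable D (EFin \o (fun w => f w * g w)).
Proof.
move=> mD mf fM ig.
apply: (@le_integrable _ _ _ _ _ _ _ (fun w => M%:E * (g w)%:E)%E) => //.
- apply/measurable_EFinP/measurable_funM => //.
  by apply/measurable_EFinP; exact: measurable_int ig.
- move=> w Dw /=; rewrite lee_fin !normrM ler_wpM2r//.
  by rewrite (le_trans (fM _ Dw))// ler_norm.
- exact: integrableZl.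
Qed.

(** Fubini for the product law; boundedness of [phi] and integrability of [psi] make the product
    integrable. *)
Lemma independent_integralM (phi : T1 -> R) (psi : T2 -> R) (M : R) :
  independent_RV X Y ->
  measurable_fun [set: T1] phi -> (forall x, `|phi x| <= M) ->
  measurable_fun [set: T2] psi ->
  P.-integrable [set: T] (fun w => (psi (Y w))%:E) ->
  (\int[P]_w (phi (X w) * psi (Y w))%:E =
   \int[P]_w (phi (X w))%:E * \int[P]_w (psi (Y w))%:E)%E.
Proof.
move=> indep mphi phiM mpsi ipsi.
pose f (z : T1 * T2) := (phi z.1 * psi z.2)%:E.
have mf : measurable_fun [set: T1 * T2] f.
  apply/measurable_EFinP/measurable_funM.
    exact: (measurableT_comp mphi).
  exact: (measurableT_comp mpsi).
have ifXY : P.-integrable [set: T] (f \o XY).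
  apply: (@bounded_integrableM _ (phi \o X) (psi \o Y) M) => //; last first.
    by move=> w _; exact: phiM.
  exact: (measurableT_comp mphi).
have if12 : (distribution P X \x distribution P Y)%E.-integrable [set: T1 * T2] f.
  apply/integrableP; split => //.
  rewrite (eq_measure_integral (distribution P XY)) => [|A mA _]; last first.
    exact: independent_distribution.
  rewrite ge0_integral_distribution//; last exact: measurableT_comp.
  by have /integrableP[] := ifXY.
have -> : (\int[P]_w (phi (X w) * psi (Y w))%:E =
    \int[distribution P X \x distribution P Y]_z f z)%E.
  rewrite (eq_measure_integral (distribution P XY)) => [|A mA _]; last first.
    exact: independent_distribution.
  by rewrite integral_distribution.
rewrite -integral12_prod_meas1//.
have iY : (distribution P Y).-integrable [set: T2] (EFin \o psi).
  by apply: integrable_pushforward => //; exact/measurable_EFinP.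
transitivity (\int[distribution P X]_x ((phi x)%:E * \int[P]_w (psi (Y w))%:E))%E.
  apply: eq_integral => x _; rewrite /fubini_F /f /=.
  under eq_integral do rewrite EFinM.
  rewrite integralZl//; congr (_ * _)%E.
  rewrite integral_distribution//.
  exact/measurable_EFinP.
have iphi : P.-integrable [set: T] (fun w => (phi (X w))%:E).
  have -> : (fun w => (phi (X w))%:E) = EFin \o (fun w => phi (X w) * cst 1 w).
    by apply/funext => w /=; rewrite mulr1.
  apply: (@bounded_integrableM _ _ _ M) => //.
  - exact: (measurableT_comp mphi).
  - exact: finite_measure_integrable_cst.
(* The integral of [psi] is finite, so it can be pulled out as a real constant. *)
have := integrable_fin_num measurableT ipsi; case: (\int[P]_w _)%E => // r _.
rewrite integralZr//.
  by congr (_ * _)%E; rewrite integral_distribution//; exact/measurable_EFinP.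
by apply: integrable_pushforward => //; exact/measurable_EFinP.
Qed.

End independence.

(** * Conditional expectation given X: a criterion and uniqueness *)

Section conditional_expectation.
Context d d1 (T : measurableType d) (T1 : measurableType d1) (R : realType)
  (P : probability T R).
Variable X : {RV P >-> T1}.

Local Notation sX := (g_sigma_algebra_preimage X).

Lemma preimage_measurable A : sX A -> measurable A.
Proof.
by move=> [B mB <-]; rewrite setTI; exact: measurable_funPTI.
Qed.

Lemma preimage_measurable_fun (Z : T -> R) :
  measurable_fun [set: g_sigma_algebra_preimageType X] Z ->
  measurable_fun [set: T] Z.
Proof. by move=> mZ _ B mB; apply: preimage_measurable; exact: mZ. Qed.

Lemma preimage_measurable_comp (z : T1 -> R) : measurable_fun [set: T1] z ->
  measurable_fun [set: g_sigma_algebra_preimageType X] (z \o X).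
Proof.
move=> mz _ B mB; exists (z @^-1` B); last by rewrite !setTI.
by rewrite -[X in measurable X]setTI; exact: mz.
Qed.

Lemma preimageI A B : sX A -> sX B -> sX (A `&` B).
Proof. exact: (@measurableI _ (g_sigma_algebra_preimageType X)). Qed.

Lemma preimageT : sX [set: T].
Proof. exact: (@measurableT _ (g_sigma_algebra_preimageType X)). Qed.

Lemma preimage_ltr (f g : T -> R) :
  measurable_fun [set: g_sigma_algebra_preimageType X] f ->
  measurable_fun [set: g_sigma_algebra_preimageType X] g ->
  sX [set w | f w < g w].
Proof.
move=> mf mg; rewrite -[X in sX X]setTI.
by have /(_ preimageT [set true]) := measurable_fun_ltr mf mg; apply.
Qed.

(** B is cut into disjoint pieces, each inside one [F k]. Countable additivity holds for Z because
    it is nonnegative on B, and for Y because it is integrable there. *)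
Let integral_cover_ge0 (F : (set T)^nat) (Y Z : T -> R) B :
  (forall k, sX (F k)) -> \bigcup_k F k = [set: T] ->
  measurable_fun [set: T] Z -> sX B ->
  (forall w, B w -> 0 <= Z w) -> P.-integrable B (EFin \o Y) ->
  (forall k A, sX A -> A `<=` F k -> A `<=` B ->
    \int[P]_(w in A) (Z w)%:E = \int[P]_(w in A) (Y w)%:E)%E ->
  (\int[P]_(w in B) (Z w)%:E = \int[P]_(w in B) (Y w)%:E)%E.
Proof.
move=> mF FT mZ mB Z0 iY ZY.
pose G k := B `&` seqDU F k.
have mG k : sX (G k).
  apply: preimageI => //.
  apply: (@measurableD _ (g_sigma_algebra_preimageType X)); first exact: mF.
  apply: (@bigsetU_measurable _ (g_sigma_algebra_preimageType X)) => i _.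
  exact: mF.
have BG : B = \bigcup_k G k.
  by rewrite -setI_bigcupr -seqDU_bigcup_eq FT setIT.
have tG : trivIset setT G by apply: trivIset_setIl; exact: trivIset_seqDU.
have mG' k : measurable (G k) by exact: preimage_measurable.
rewrite BG ge0_integral_bigcup//; last 2 first.
- by apply/measurable_EFinP; exact: measurable_funTS.
- by rewrite -BG => w Bw; rewrite lee_fin Z0.
rewrite integral_bigcup -?BG//; apply: eq_eseriesr => k _.
apply: (ZY k) => //; last by move=> w [].
by move=> w [_]; exact: subset_seqDU.
Qed.

(* The hypotheses only concern events inside some F k, and Z need not be
   integrable on larger ones. On an event where Y is integrable, split along the
   sign of Z and sum over the disjointified cover; sigma-additivity for Y then
   forces the integral of |Z| to be finite. *)
Lemma is_cond_expectation_cover (F : (set T)^nat) (Y Z : T -> R) :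
  measurable_fun [set: g_sigma_algebra_preimageType X] Z ->
  (forall k, sX (F k)) -> \bigcup_k F k = [set: T] ->
  (forall k, P.-integrable (F k) (EFin \o Y)) ->
  (forall k A, sX A -> A `<=` F k ->
    \int[P]_(w in A) (Z w)%:E = \int[P]_(w in A) (Y w)%:E)%E ->
  is_cond_expectation X Y Z.
Proof.
move=> mZX mF FT iYF ZY; have mZ := preimage_measurable_fun mZX.
split=> //; first by exists F.
move=> A sA iY; have mA := preimage_measurable sA.
pose N := [set w | Z w < 0].
have sN : sX N by apply: preimage_ltr => //; exact: measurable_cst.
have sAN : sX (A `&` N) by exact: preimageI.
have sAP : sX (A `&` ~` N).
  apply: preimageI => //.
  exact: (@measurableC _ (g_sigma_algebra_preimageType X)).
have mAN := preimage_measurable sAN; have mAP := preimage_measurable sAP.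
have iYN : P.-integrable (A `&` N) (EFin \o Y) by exact: integrableS iY.
have iYP : P.-integrable (A `&` ~` N) (EFin \o Y) by exact: integrableS iY.
have ZP w : (A `&` ~` N) w -> 0 <= Z w by move=> [_ /negP]; rewrite -leNgt.
have ZN w : (A `&` N) w -> 0 <= - Z w by move=> [_ /ltW]; rewrite oppr_ge0.
have eP : (\int[P]_(w in A `&` ~` N) (Z w)%:E =
           \int[P]_(w in A `&` ~` N) (Y w)%:E)%E.
  apply: (integral_cover_ge0 mF) => // k B sB BF _; exact: ZY BF.
have eN : (\int[P]_(w in A `&` N) (- Z w)%:E =
           \int[P]_(w in A `&` N) (- Y w)%:E)%E.
  apply: (@integral_cover_ge0 F (fun w => - Y w) (fun w => - Z w)) => //.
  - exact: measurable_funN.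
  - by rewrite (_ : EFin \o _ = \- (EFin \o Y))%E//; exact: integrableN.
  - move=> k B sB BF BAN; have mB := preimage_measurable sB.
    apply: oppe_inj; rewrite -integral_ge0N => [|w /BAN /ZN]; last by rewrite lee_fin.
    rewrite -integralN; last first.
      apply: integrable_add_def => //.
      rewrite (_ : (fun x => _) = \- (EFin \o Y))%E//; apply: integrableN => //.
      exact: integrableS iYN.
    under eq_integral do rewrite -EFinN opprK.
    under [RHS]eq_integral do rewrite -EFinN opprK.
    exact: ZY BF.
have eA : A = (A `&` N) `|` (A `&` ~` N) by rewrite -setIUr setUv setIT.
have dA : [disjoint A `&` N & A `&` ~` N].
  by apply/disj_setPS => w [[_ ?] [_]].
have mZA D : measurable_fun D (EFin \o Z).
  by apply/measurable_EFinP; exact: measurable_funTS.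
have iZP : P.-integrable (A `&` ~` N) (EFin \o Z).
  apply/integrableP; split => //.
  rewrite (eq_integral (EFin \o Z)) => [|w /[!inE] /ZP ?]; last first.
    by rewrite /= ger0_norm.
  by rewrite eP; exact: integrable_lty iYP.
have iZN : P.-integrable (A `&` N) (EFin \o Z).
  apply/integrableP; split => //.
  rewrite (eq_integral (EFin \o (fun w => - Z w))) => [|w /[!inE] /ZN ?]; last first.
    by rewrite /= -normrN ger0_norm.
  rewrite eN; apply: integrable_lty => //.
  by rewrite (_ : (fun x => _) = \- (EFin \o Y))%E//; exact: integrableN.
have iZ : P.-integrable A (EFin \o Z).
  apply/integrableP; split => //.
  rewrite eA ge0_integral_setU//; last exact: measurableT_comp.
  apply: lte_add_pinfty.
    by have /integrableP[] := iZN.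
  by have /integrableP[] := iZP.
split=> //; rewrite eA integral_setU//.
rewrite integral_setU//; last first.
  by rewrite -eA; exact: measurable_int iY.
congr (_ + _)%E => //; apply: oppe_inj.
rewrite -integralN; last exact: integrable_add_def.
by rewrite -integralN; [exact: eN|exact: integrable_add_def].
Qed.

(** On [F k] intersected with the event Z1 < Z2, both integrals equal that of Y. The positive
    function Z2 - Z1 thus has integral zero there, so each piece is null, and countably many pieces
    cover the event. *)
Let cond_expectation_lt_negligible (Y Z1 Z2 : T -> R) :
  is_cond_expectation X Y Z1 -> is_cond_expectation X Y Z2 ->
  P.-negligible [set w | Z1 w < Z2 w].
Proof.
move=> [mZ1 [F [mF FT iYF]] YZ1] [mZ2 _ YZ2].
set N := [set w | _]; have sN : sX N by exact: preimage_ltr.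
rewrite -(setTI N) -FT setI_bigcupl; apply: negligible_bigcup => k.
have sA : sX (F k `&` N) by exact: preimageI.
have mA := preimage_measurable sA.
have iY : P.-integrable (F k `&` N) (EFin \o Y).
  by apply: integrableS (iYF k) => //; exact: preimage_measurable.
have [iZ1 e1] := YZ1 _ sA iY; have [iZ2 e2] := YZ2 _ sA iY.
have : (\int[P]_(w in F k `&` N) `|(Z2 w)%:E - (Z1 w)%:E| = 0)%E.
  rewrite (eq_integral (fun w => (Z2 w)%:E - (Z1 w)%:E)%E).
    by rewrite integralB_EFin// e1 e2 subee//; exact: integrable_fin_num iY.
  move=> w /[!inE] -[_ /= Nw].
  by rewrite -EFinB /= ger0_norm// subr_ge0 ltW.
have mB : measurable_fun (F k `&` N) (fun w => (Z2 w)%:E - (Z1 w)%:E)%E.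
  by apply: emeasurable_funB; [exact: measurable_int iZ2|exact: measurable_int iZ1].
move=> /(ae_eq_integral_abs P mA mB); apply: negligibleS => w [Fw Nw] /= h.
have /eqP := h (conj Fw Nw).
by rewrite -EFinB eqe subr_eq0 gt_eqF.
Qed.

Lemma is_cond_expectation_uniq (Y Z1 Z2 : T -> R) :
  is_cond_expectation X Y Z1 -> is_cond_expectation X Y Z2 ->
  ae_eq P [set: T] Z1 Z2.
Proof.
move=> YZ1 YZ2.
have := negligibleU (cond_expectation_lt_negligible YZ1 YZ2)
                    (cond_expectation_lt_negligible YZ2 YZ1).
apply: negligibleS => w /= /not_implyP[_ /eqP].
by rewrite neq_lt => /orP[|]; [left|right].
Qed.

(** Needed because the conditional mean inside a covariance is fixed only almost everywhere, so two
    choices of it give centred products that differ on a null set. *)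
Lemma is_cond_expectation_ae_eq (Y Y' Z : T -> R) :
  measurable_fun [set: T] Y -> measurable_fun [set: T] Y' ->
  ae_eq P [set: T] Y Y' ->
  is_cond_expectation X Y Z -> is_cond_expectation X Y' Z.
Proof.
move=> mY mY' YY' [mZ [F [mF FT iYF]] YZ].
have mE (f : T -> R) A : measurable_fun [set: T] f ->
    measurable_fun A (EFin \o f).
  by move=> mf; apply/measurable_EFinP; exact: measurable_funTS.
have tr (U V : T -> R) A : measurable_fun [set: T] U ->
    measurable_fun [set: T] V -> ae_eq P [set: T] U V ->
    sX A -> P.-integrable A (EFin \o U) -> P.-integrable A (EFin \o V).
  move=> mU mV UV sA /integrableP[_ iU]; have mA := preimage_measurable sA.
  apply/integrableP; split; first exact: mE.
  rewrite (ae_eq_integral (fun w => `|(U w)%:E|)%E)//.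
  - exact/measurableT_comp/mE.
  - exact/measurableT_comp/mE.
  - by apply: filterS UV => w /(_ I) ->.
split=> //; first by exists F; split=> // k; exact: tr (iYF k).
move=> A sA iY'; have mA := preimage_measurable sA.
have iY : P.-integrable A (EFin \o Y) by apply: tr iY' => //; exact: ae_eq_sym.
have [iZ e] := YZ _ sA iY; split => //; rewrite e.
apply: ae_eq_integral => //; [exact: mE|exact: mE|].
by apply: filterS YY' => w /(_ I) ->.
Qed.

End conditional_expectation.

(** * Conditioning sums of products of functions of independent variables *)

Section conditional_expectation_independent.
Context d d1 d2 (T : measurableType d) (T1 : measurableType d1)
  (T2 : measurableType d2) (R : realType) (P : probability T R).
Variables (X : {RV P >-> T1}) (Y : {RV P >-> T2}).
Variables (I : finType) (phi : I -> T1 -> R) (psi : I -> T2 -> R) (c : I -> R).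
Hypothesis XY_indep : independent_RV X Y.
Hypothesis mphi : forall i, measurable_fun [set: T1] (phi i).
Hypothesis mpsi : forall i, measurable_fun [set: T2] (psi i).
Hypothesis ipsi : forall i, P.-integrable [set: T] (fun w => (psi i (Y w))%:E).
Hypothesis psiE : forall i, (\int[P]_w (psi i (Y w))%:E = (c i)%:E)%E.

Let s (x : T1) : R := \sum_i `|phi i x|.

Let ms : measurable_fun [set: T1] s.
Proof. by apply: measurable_sum => i; exact: measurableT_comp. Qed.

(** Events of sigma(X) on which all the [phi i] are bounded at once. They provide the countable
    cover, since [phi i] of X, such as an entry of the pseudoinverse, may fail to be integrable. *)
Let F k := [set w | s (X w) < k%:R].

Let phi_bound k i w : F k w -> `|phi i (X w)| <= k%:R.
Proof.
move=> /ltW; apply: le_trans; rewrite /s (bigD1 i)//= lerDl.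
exact: sumr_ge0.
Qed.

Let sF k : g_sigma_algebra_preimage X (F k).
Proof.
apply: preimage_ltr; last exact: measurable_cst.
exact: (preimage_measurable_comp (z := s)).
Qed.

Let integrable_term k i A : measurable A -> A `<=` F k ->
  P.-integrable A (EFin \o (fun w => phi i (X w) * psi i (Y w))).
Proof.
move=> mA AF; apply: (@bounded_integrableM _ _ _ _ _ _ _ k%:R) => //.
- by apply: measurable_funTS; exact: (measurableT_comp (mphi i)).
- by move=> w /AF; exact: phi_bound.
- exact: integrableS (ipsi i).
Qed.

Let integrable_cond_term k i A : measurable A -> A `<=` F k ->
  P.-integrable A (EFin \o (fun w => phi i (X w) * c i)).
Proof.
move=> mA AF.
apply: (@bounded_integrableM _ _ _ _ _ (fun w => phi i (X w)) (fun=> c i) k%:R) => //.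
- by apply: measurable_funTS; exact: (measurableT_comp (mphi i)).
- by move=> w /AF; exact: phi_bound.
- exact: finite_measure_integrable_cst.
Qed.

(** Restriction to A is absorbed into [phi i] by an indicator in the X variable; the truncated
    factor is bounded, so independence factors the integral. *)
Let integral_term k i A : g_sigma_algebra_preimage X A -> A `<=` F k ->
  (\int[P]_(w in A) (phi i (X w) * psi i (Y w))%:E =
   \int[P]_(w in A) (phi i (X w) * c i)%:E)%E.
Proof.
move=> sA AF; have mA := preimage_measurable sA; move: sA => [B mB].
rewrite setTI => BA.
(* A is the preimage of B', on which the phi i are bounded. *)
pose B' := B `&` [set x | s x < k%:R].
have mB' : measurable B'.
  apply: measurableI => //; rewrite -[X in measurable X]setTI.
  have := measurable_fun_ltr ms (measurable_cst (k%:R : R)).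
  by move=> /(_ measurableT [set true]); apply.
have XB' w : (w \in A) = (X w \in B').
  apply/idP/idP => /[!inE]; last by move=> [Bw _]; rewrite -BA.
  by move=> Aw; split; [rewrite -BA in Aw|exact: AF].
have patchE' (g : T -> R) :
    ((fun w => (phi i (X w) * g w)%:E) \_ A =
     (fun w => ((phi i \* \1_B') (X w) * g w)%:E))%E.
  apply/funext => w; rewrite patchE /= indicE -XB'.
  by case: ifPn => _; rewrite ?mulr1// mulr0 mul0r.
rewrite integral_mkcond [RHS]integral_mkcond !patchE'.
have mphi' : measurable_fun [set: T1] (phi i \* \1_B').
  by apply: measurable_funM => //; exact: measurable_indic.
have phi'k x : `|(phi i \* \1_B') x| <= k%:R.
  rewrite /= indicE; case: (boolP (x \in B')) => /=; last by rewrite mulr0 normr0.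
  rewrite inE => -[_ /= /ltW sk]; rewrite mulr1; apply: le_trans sk.
  by rewrite /s (bigD1 i)//= lerDl sumr_ge0.
rewrite (independent_integralM XY_indep mphi' phi'k (mpsi i) (ipsi i)) psiE.
under [RHS]eq_integral do rewrite EFinM.
rewrite integralZr//.
have -> : (fun w => ((phi i \* \1_B') (X w))%:E) =
    EFin \o (fun w => (phi i \* \1_B') (X w) * cst 1 w).
  by apply/funext => w /=; rewrite mulr1.
apply: (@bounded_integrableM _ _ _ _ _ _ _ k%:R) => //.
- exact: (measurableT_comp mphi').
- exact: finite_measure_integrable_cst.
Qed.

(** Each function of X is kept, and each function of Y is replaced by its mean. It serves for both
    the conditional mean and the conditional covariance of the estimator. *)
Lemma is_cond_expectation_sum :
  is_cond_expectation X (fun w => \sum_i phi i (X w) * psi i (Y w))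
                        (fun w => \sum_i phi i (X w) * c i).
Proof.
apply: (@is_cond_expectation_cover _ _ _ _ _ _ _ F) => //.
- apply: (preimage_measurable_comp (z := fun x => \sum_i phi i x * c i)).
  by apply: measurable_sum => i; exact: measurable_funM.
(* The inequality defining [F k] is strict, hence the successor of the integer part. *)
- apply/seteqP; split => // w _; exists (Num.truncn (s (X w))).+1 => //.
  exact: truncnS_gt.
- move=> k; have mF : measurable (F k) by exact: (preimage_measurable (sF k)).
  rewrite (_ : EFin \o _ =
      (fun w => \sum_i (phi i (X w) * psi i (Y w))%:E)%E); last first.
    by apply/funext => w /=; rewrite sumEFin.
  by apply: integrable_sum => // i _; exact: (integrable_term i mF (@subset_refl _ _)).
- move=> k A sA AF; have mA := preimage_measurable sA.
  under eq_integral do rewrite -sumEFin.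
  under [RHS]eq_integral do rewrite -sumEFin.
  rewrite !integral_sum//.
  + by apply: eq_bigr => i _; rewrite (integral_term i sA AF).
  + move=> i; exact: (integrable_term i mA AF).
  + move=> i; exact: (integrable_cond_term i mA AF).
Qed.

End conditional_expectation_independent.

(** * Expectations under a left-spherical law *)

Section left_spherical_expectation.
Context d (T : measurableType d) (R : realType) (P : probability T R).
Variables (n p : nat) (X : {RV P >-> borel_mx R n p}).

Let pinv (x : borel_mx R n p) : 'M[R]_(p, n) := mpinv (x : 'M[R]_(n, p)).

Lemma measurable_pinv : measurable_entries pinv.
Proof.
by apply: measurable_entries_mpinv; exact: measurable_entries_id.
Qed.

Section rotation.
Variables (O : 'M[R]_n).
Hypothesis oO : orthogonal_mx O.

Let OX w : borel_mx R n p := O *m (X w : 'M[R]_(n, p)).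

Let mOX : measurable_fun [set: T] OX.
Proof.
apply/measurable_borel_mxP/measurable_entries_mul.
  exact: measurable_entries_cst.
by apply/(measurable_borel_mxP X); exact: measurable_funP.
Qed.

HB.instance Definition _ := isMeasurableFun.Build _ _ _ _ OX mOX.

(** Both sides are integrals of f, against the laws of X and of O X, which agree by hypothesis.
    Nonnegativity of f lets the values be infinite. *)
Lemma left_spherical_integral (f : borel_mx R n p -> R) :
  left_spherical X -> measurable_fun [set: borel_mx R n p] f ->
  (forall x, 0 <= f x) ->
  (\int[P]_w (f (X w))%:E =
   \int[P]_w (f (O *m (X w : 'M[R]_(n, p)) : borel_mx R n p))%:E)%E.
Proof.
move=> sX mf f0.
have mEf : measurable_fun [set: borel_mx R n p] (EFin \o f).
  exact/measurable_EFinP.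
have f0' y : (0 <= (EFin \o f) y)%E by rewrite lee_fin.
have := ge0_integral_distribution (X : {RV P >-> borel_mx R n p}) mEf f0'.
have := ge0_integral_distribution (OX : {RV P >-> borel_mx R n p}) mEf f0'.
rewrite /comp /= => <- <-.
by apply: eq_measure_integral => A mA _; exact/esym/(sX O oO).
Qed.

End rotation.

Lemma measurable_pinv_conj (S : 'M[R]_n) :
  measurable_fun [set: borel_mx R n p]
    (fun x => \tr (pinv x *m S *m (pinv x)^T)).
Proof.
apply/measurable_mxtrace/measurable_entries_mul.
  apply: measurable_entries_mul; first exact: measurable_pinv.
  exact: measurable_entries_cst.
by apply: measurable_entries_tr; exact: measurable_pinv.
Qed.

Lemma left_spherical_twirl (S : 'M[R]_n) : (0 < n)%N -> left_spherical X ->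
  (forall v : 'cV[R]_n, 0 <= (v^T *m S *m v) ord0 ord0) ->
  (\int[P]_w (\tr (pinv (X w) *m S *m (pinv (X w))^T))%:E =
   (\tr S / n%:R)%:E * \int[P]_w (\tr (pinv (X w) *m (pinv (X w))^T))%:E)%E.
Proof.
move=> n0 sX S0; have [I [Q [I0 oQ twirlE]]] := orthogonal_twirl R n0.
pose f x := \tr (pinv x *m S *m (pinv x)^T).
have f_ge0 x : 0 <= f x by exact: psd_mxtrace_conj_ge0.
have mf : measurable_fun [set: borel_mx R n p] f by exact: measurable_pinv_conj.
pose g i x := \tr (pinv x *m ((Q i)^T *m S *m Q i) *m (pinv x)^T).
have fO i x : f (Q i *m (x : 'M[R]_(n, p)) : borel_mx R n p) = g i x.
  by rewrite /f /g /pinv mpinv_orthogonalMl// trmx_mul trmxK !mulmxA.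
have sum_g x : \sum_i g i x =
    #|I|%:R * (\tr S / n%:R) * \tr (pinv x *m (pinv x)^T).
  rewrite /g -linear_sum/= -mulmx_suml -mulmx_sumr twirlE.
  by rewrite mul_mx_scalar -scalemxAl mxtraceZ.
have tr_ge0 x : 0 <= \tr (pinv x *m (pinv x)^T).
  exact: mxtrace_gram_ge0.
have mtr : measurable_fun [set: borel_mx R n p]
    (fun x => \tr (pinv x *m (pinv x)^T)).
  apply/measurable_mxtrace/measurable_entries_mul; first exact: measurable_pinv.
  by apply: measurable_entries_tr; exact: measurable_pinv.
have trS0 : 0 <= \tr S.
  by have := psd_mxtrace_conj_ge0 1%:M S0; rewrite mul1mx trmx1 mulmx1.
(* Both sides equal the sum over i of the integrals of [g i]: sphericity makes each one the integral
   of f, while the twirl identity evaluates their pointwise sum. *)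
have : (#|I|%:R%:E * \int[P]_w (f (X w))%:E =
        (#|I|%:R * (\tr S / n%:R))%:E *
          \int[P]_w (\tr (pinv (X w) *m (pinv (X w))^T))%:E)%E.
  transitivity (\sum_(i : I) \int[P]_w (g i (X w))%:E)%E.
    under eq_bigr => i _.
      under eq_integral do rewrite -fO.
      rewrite -left_spherical_integral//.
      over.
    by rewrite sumr_const mule_natl.
  rewrite -ge0_integral_sum//.
  - under eq_integral do rewrite sumEFin sum_g EFinM.
    rewrite ge0_integralZl_EFin//.
    + by move=> w _; rewrite lee_fin.
    + apply/measurable_EFinP; exact: (measurableT_comp mtr).
    + by rewrite !mulr_ge0 ?invr_ge0.
  - move=> i; apply/measurable_EFinP.
    apply: (measurableT_comp (f := g i)) => //; exact: measurable_pinv_conj.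
  - by move=> i w _; rewrite lee_fin -fO.
rewrite EFinM -muleA.
have I0' : (#|I|%:R : R) != 0 by rewrite pnatr_eq0 -lt0n.
(* The integrals may be infinite, so the nonzero finite factor is cancelled by multiplying by its
   inverse. *)
move/(congr1 (fun z => (#|I|%:R^-1)%:E * z)%E).
by rewrite !muleA -!EFinM mulVf// mul1e mul1r.
Qed.

End left_spherical_expectation.

(** * Expected conditional variance of the ridgeless estimator *)

Theorem theorem3p3 (R : realType) (d : measure_display) (T : measurableType d)
  (P : probability T R) (n p : nat) (n_ge1 : (1 <= n)%N) (p_gtn : (n < p)%N)
  (beta : 'cV[R]_p)
  (X : {RV P >-> borel_mx R n p}) (eps : {RV P >-> borel_mx R n 1})
  (X_eps_indep : independent_RV X eps)
  (eps_integrable : forall i : 'I_n,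
     P.-integrable [set: T] (fun w => ((eps w : 'cV[R]_n) i ord0)%:E))
  (eps_mean0 : forall i : 'I_n,
     ('E_P[fun w => (eps w : 'cV[R]_n) i ord0] = 0)%E)
  (Omega : 'M[R]_n)
  (Omega_finite : forall i j : 'I_n,
     P.-integrable [set: T]
       (fun w => (((eps w : 'cV[R]_n) *m (eps w : 'cV[R]_n)^T) i j)%:E))
  (OmegaE : forall i j : 'I_n,
     ('E_P[fun w => ((eps w : 'cV[R]_n) *m (eps w : 'cV[R]_n)^T) i j]
        = (Omega i j)%:E)%E)
  (Omega_posdef : posdef_mx Omega)
  (X_left_spherical : left_spherical X)
  (y : T -> 'cV[R]_n)
  (yE : forall w, y w = (X w : 'M[R]_(n, p)) *m beta + (eps w : 'cV[R]_n))
  (betahat : T -> 'cV[R]_p)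
  (betahatE : forall w, betahat w = ridgeless (X w : 'M[R]_(n, p)) (y w))
  (U Lambda : T -> 'M[R]_n)
  (eigenX : forall w, is_eigendecomposition
     (p%:R^-1 *: ((X w : 'M[R]_(n, p)) *m (X w : 'M[R]_(n, p))^T))
     (U w) (Lambda w)) :
  (exists V : T -> R, is_cond_variance X betahat V) /\
  forall V : T -> R, is_cond_variance X betahat V ->
    ('E_P[V] =
       ((n%:R * p%:R)^-1 * \tr Omega)%:E * 'E_P[fun w => \tr (mpinv (Lambda w))])%E.
Proof.
have mX : measurable_entries (fun w => X w : 'M[R]_(n, p)).
  by apply/(measurable_borel_mxP X); exact: measurable_funP.
have meps_coord a : measurable_fun [set: borel_mx R n 1]
    (fun e => (e : 'cV[R]_n) a ord0).
  exact: measurable_entries_id.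
pose B (x : borel_mx R n p) := mpinv (x : 'M[R]_(n, p)).
have mB : measurable_entries B by exact: measurable_pinv.
have mBX : measurable_entries (fun w => B (X w)).
  exact: measurable_entries_mpinv.
pose mu w := B (X w) *m ((X w : 'M[R]_(n, p)) *m beta).
pose C w := B (X w) *m Omega *m (B (X w))^T.
have betahat_mu w : betahat w = mu w + B (X w) *m (eps w : 'cV[R]_n).
  by rewrite betahatE yE /ridgeless mulmxDr.
have mmu : measurable_entries mu.
  apply: measurable_entries_mul => //.
  by apply: measurable_entries_mul => //; exact: measurable_entries_cst.
have meps : measurable_entries (fun w => eps w : 'cV[R]_n).
  by apply/(measurable_borel_mxP eps); exact: measurable_funP.
have mbetahat : measurable_entries betahat.
  move=> i j; under eq_fun do rewrite betahat_mu; move: i j.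
  by apply: measurable_entries_add => //; exact: measurable_entries_mul.
have ce_mu i : is_cond_expectation X (fun w => betahat w i ord0)
                                     (fun w => mu w i ord0).
  (* 'I_1 indexes the noiseless term, 'I_n the coordinates of eps. *)
  pose phi (o : 'I_1 + 'I_n) (x : borel_mx R n p) : R :=
    if o is inr a then B x i a else (B x *m ((x : 'M[R]_(n, p)) *m beta)) i ord0.
  pose psi (o : 'I_1 + 'I_n) (e : borel_mx R n 1) : R :=
    if o is inr a then (e : 'cV[R]_n) a ord0 else 1.
  pose c (o : 'I_1 + 'I_n) : R := if o is inr a then 0 else 1.
  have -> : (fun w => betahat w i ord0) =
      (fun w => \sum_o phi o (X w) * psi o (eps w)).
    apply/funext => w; rewrite betahat_mu big_sumType big_ord1 /= mulr1 mxE; congr (_ + _).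
    by rewrite mxE.
  have -> : (fun w => mu w i ord0) = (fun w => \sum_o phi o (X w) * c o).
    apply/funext => w; rewrite big_sumType big_ord1 /= mulr1 big1 ?addr0// => a _.
    by rewrite mulr0.
  apply: is_cond_expectation_sum => //.
  - move=> [k|a]; last exact: mB.
    apply: (measurable_entries_mul mB); apply: measurable_entries_mul.
      exact: measurable_entries_id.
    exact: measurable_entries_cst.
  - by move=> [k|a]; [exact: measurable_cst|exact: meps_coord].
  - move=> [k|a]; last exact: eps_integrable.
    exact: (finite_measure_integrable_cst P 1).
  - move=> [k|a]; last by have := eps_mean0 a; rewrite unlock.
    by rewrite /= integral_cst//= probability_setT mule1.
have ce_C i j : is_cond_expectation X
    (fun w => (betahat w i ord0 - mu w i ord0) * (betahat w j ord0 - mu w j ord0))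
    (fun w => C w i j).
  (* The centred product is a product of two linear forms in eps; expanded over pairs of
     coordinates, its noise factors have the entries of Omega as means. *)
  pose phi (u : 'I_n * 'I_n) (x : borel_mx R n p) : R := B x i u.1 * B x j u.2.
  pose psi (u : 'I_n * 'I_n) (e : borel_mx R n 1) : R :=
    ((e : 'cV[R]_n) *m (e : 'cV[R]_n)^T) u.1 u.2.
  have -> : (fun w => (betahat w i ord0 - mu w i ord0) *
                      (betahat w j ord0 - mu w j ord0)) =
      (fun w => \sum_u phi u (X w) * psi u (eps w)).
    apply/funext => w; rewrite !betahat_mu ![(mu w + _) _ _]mxE.
    rewrite !(addrC (mu w _ _)) !addrK !mxE big_distrlr/= pair_bigA/=.
    by apply: eq_bigr => u _; rewrite /phi /psi [in RHS]mxE big_ord1 mxE mulrACA.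
  have -> : (fun w => C w i j) = (fun w => \sum_u phi u (X w) * Omega u.1 u.2).
    apply/funext => w; rewrite /C mxE.
    under eq_bigr do rewrite !mxE mulr_suml.
    rewrite exchange_big pair_bigA/=; apply: eq_bigr => u _.
    by rewrite mulrAC.
  apply: is_cond_expectation_sum => //.
  - by move=> u; apply: measurable_funM; exact: mB.
  - move=> u; rewrite (_ : psi u =
        fun e => (e : 'cV[R]_n) u.1 ord0 * (e : 'cV[R]_n) u.2 ord0).
      by apply: measurable_funM; exact: meps_coord.
    by apply/funext => e; rewrite /psi mxE big_ord1 mxE.
  - by move=> u; exact: Omega_finite.
  - by move=> u; have := OmegaE u.1 u.2; rewrite unlock.
split; first by exists (fun w => \tr (C w)), C => //; exists mu.
move=> V [C' [mu' ce_mu' ce_C'] VE].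
(* An arbitrary version may use another mean [mu']. Since [mu'] equals [mu] almost everywhere, [C']
   is also a version for the products centred at [mu], and uniqueness applies. *)
have aeC i : ae_eq P [set: T] (fun w => C' w i i) (fun w => C w i i).
  apply: is_cond_expectation_uniq (ce_C i i).
  apply: is_cond_expectation_ae_eq (ce_C' i i).
  - have mmu' : measurable_fun [set: T] (fun w => mu' w i ord0).
      by have [/preimage_measurable_fun] := ce_mu' i.
    by apply: measurable_funM; apply: measurable_funB => //; exact: mbetahat.
  - by apply: measurable_funM; apply: measurable_funB => //; exact: mbetahat.
  - have := is_cond_expectation_uniq (ce_mu' i) (ce_mu i).
    by apply: filterS => w /= h _; rewrite h.
have aeV : ae_eq P [set: T] (EFin \o V) (fun w => (\tr (C w))%:E).
  have : \forall w \ae P, forall i, C' w i i = C w i i.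
    apply: filter_forall => i; apply: filterS (aeC i) => w; exact.
  by apply: filterS => w h _ /=; rewrite VE; congr (_%:E); apply: eq_bigr.
have mV : measurable_fun [set: T] V.
  rewrite (_ : V = fun w => \tr (C' w)); last exact/funext.
  by apply: measurable_sum => i; have [/preimage_measurable_fun] := ce_C' i i.
have mtr (S : 'M[R]_n) :
    measurable_fun [set: T] (fun w => \tr (B (X w) *m S *m (B (X w))^T)).
  exact: (measurableT_comp (measurable_pinv_conj S)).
rewrite unlock (ae_eq_integral (fun w => (\tr (C w))%:E))//; last 2 first.
- exact/measurable_EFinP.
- exact/measurable_EFinP/mtr.
rewrite left_spherical_twirl//; last first.
  move=> v; have [->|v0] := eqVneq v 0; first by rewrite mulmx0 mxE.
  by apply/ltW; exact: Omega_posdef.2.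
have p0 : (p%:R : R) != 0 by rewrite pnatr_eq0 -lt0n (leq_ltn_trans _ p_gtn).
(* The factor p is the inverse of the scalar 1/p in front of X X^T. It later cancels the p in
   1/(np). *)
have trE w : \tr (mpinv (Lambda w)) = p%:R * \tr (B (X w) *m (B (X w))^T).
  have [oU _ eX] := eigenX w.
  rewrite -(mxtrace_mpinv_conj _ oU) -eX mpinvZ ?invr_eq0// invrK mxtraceZ.
  by rewrite mpinv_gram mxtrace_mulC.
under [in RHS]eq_integral do rewrite trE EFinM.
have n0 : (n%:R : R) != 0 by rewrite pnatr_eq0 -lt0n.
rewrite ge0_integralZl_EFin//.
- by rewrite muleA -EFinM; congr ((_%:E) * _)%E; field; rewrite p0 n0.
- by move=> w _; rewrite lee_fin mxtrace_gram_ge0.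
- apply/measurable_EFinP; have := mtr 1%:M.
  by under eq_fun do rewrite mulmx1.
Qed.
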